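(* Let $q=p^l$ be a prime power ($p$ prime) and $\mathbb{F}_q$ the finite field of order $q$. Let $\mathcal{D}$ be a $1$-$(v,k,r)$ design with blocks $B_1,\ldots,B_b$ and let $M$ be its $b\times v$ incidence matrix. Let $a,d\in\mathbb{F}_p$ be residues such that $k\equiv a \pmod p$ and $|B_i\cap B_j|\equiv d \pmod p$ for all $i,j\in\{1,\ldots,b\}$, $i\neq j$. Then: 1. If $a=d=0$, then $M$ generates a self-orthogonal code over $\mathbb{F}_q$. 2. If $a=0$ and $d\neq 0$, then the matrix $[\sqrt{d}\cdot I_b,\ M,\ \sqrt{-d}\cdot\mathbf{1}]$ generates a $b$-dimensional self-orthogonal code over $\mathbb{F}$, where $\mathbb{F}=\mathbb{F}_q$ if $d$ and $-d$ are squares in $\mathbb{F}_q$, and $\mathbb{F}=\mathbb{F}_{q^2}$ otherwise. 3. If $a\neq 0$ and $d=0$, then the matrix $[\sqrt{-a}\cdot I_b,\ M]$ generates a $b$-dimensional self-orthogonal code over $\mathbb{F}$, where $\mathbb{F}=\mathbb{F}_q$ if $-a$ is a square in $\mathbb{F}_q$, and $\mathbb{F}=\mathbb{F}_{q^2}$ otherwise. If $b=v$, the obtained code is self-dual. 4. If $a\neq 0$ and $d\neq 0$, there are two cases: (a) if $a=d$, then the matrix $[M,\ \sqrt{-a}\cdot\mathbf{1}]$ generates a self-orthogonal code over $\mathbb{F}$, where $\mathbb{F}=\mathbb{F}_q$ if $-a$ is a square in $\mathbb{F}_q$, and $\mathbb{F}=\mathbb{F}_{q^2}$ otherwise; (b)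 if $a\neq d$, then the matrix $[\sqrt{d-a}\cdot I_b,\ M,\ \sqrt{-d}\cdot\mathbf{1}]$ generates a $b$-dimensional self-orthogonal code over $\mathbb{F}$, where $\mathbb{F}=\mathbb{F}_q$ if $d-a$ and $-d$ are squares in $\mathbb{F}_q$, and $\mathbb{F}=\mathbb{F}_{q^2}$ otherwise.
   Context: A $1$-$(v,k,r)$ design is a finite incidence structure with $v$ points and $b$ blocks such that every block is incident with exactly $k$ points and every point is incident with exactly $r$ blocks. For blocks $B_i,B_j$, $|B_i\cap B_j|$ is the number of points incident with both. The incidence matrix is the $b\times v$ matrix $M=[m_{i,j}]$ with $m_{i,j}=1$ if point $P_j$ is incident with block $B_i$ and $m_{i,j}=0$ otherwise; its entries are viewed in the field under consideration. $I_b$ is the $b\times b$ identity matrix, $\mathbf{1}$ is the all-one column, and $[X,Y,\ldots]$ denotes horizontal concatenation. The code generated by a matrix over a field is the span of its rows over that field. For $c\in\mathbb{F}_p$, viewed in the field $\mathbb{F}$, $\sqrt{c}$ denotes an element of $\mathbb{F}$ whose square is $c$. A code $C\subseteq\mathbb{F}^n$ is self-orthogonal if $C\subseteq C^\perp$ and self-dual if $C=C^\perp$, where $C^\perp$ is the dual under the standard (bilinear) inner product. *)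

(* Defs.v *)
From HB Require Import structures.
From mathcomp Require Import all_boot all_order all_algebra all_field.

Set Implicit Arguments.
Unset Strict Implicit.
Unset Printing Implicit Defensive.

Import GRing.Theory.
Local Open Scope ring_scope.

Section Designs.

Variables v b : nat.

(* [inc P B] means that the point [P] is incident with the block [B]. Distinct
   blocks may be incident with the same points. *)
Variable inc : 'I_v -> 'I_b -> bool.

Definition block_pts (B : 'I_b) : {set 'I_v} := [set P | inc P B].

Definition is_1design (k r : nat) : Prop :=
  (forall B : 'I_b, #|block_pts B| = k) /\
  (forall P : 'I_v, #|[set B | inc P B]| = r).

Definition incidence_mx (F : finFieldType) : 'M[F]_(b, v) :=
  \matrix_(i, j) (inc j i)%:R.

End Designs.

Section Codes.

Variables (F : finFieldType) (n : nat).

Definition gen_code m (G : 'M[F]_(m, n)) : {vspace 'rV[F]_n} :=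
  <<[seq row i G | i : 'I_m]>>%VS.

Definition inner (x y : 'rV[F]_n) : F := \sum_(i < n) x 0 i * y 0 i.

Definition dual_code (C : {vspace 'rV[F]_n}) : {set 'rV[F]_n} :=
  [set x | [forall (y | y \in C), inner x y == 0]].

Definition self_orthogonal (C : {vspace 'rV[F]_n}) : Prop :=
  {subset C <= dual_code C}.

Definition self_dual (C : {vspace 'rV[F]_n}) : Prop := C =i dual_code C.

End Codes.

Section PrimeSubfield.

Variable p : nat.

(* The image of a residue mod [p]; this is the embedding of 'F_p into [F] when
   [p] is the characteristic of [F], the only case in which it is used. *)
Definition of_Fp (F : finFieldType) (c : 'F_p) : F := (c : nat)%:R.

Definition is_sqrt (F : finFieldType) (c : 'F_p) (s : F) : Prop :=
  s ^+ 2 = of_Fp F c.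

Definition is_square_in (F : finFieldType) (c : 'F_p) : bool :=
  [exists s : F, s ^+ 2 == of_Fp F c].

(* [K] if all the residues in [cs] are squares in [K], and [L] otherwise. *)
Definition sqrt_field (K L : finFieldType) (cs : seq 'F_p) : finFieldType :=
  if all (is_square_in K) cs then K else L.

End PrimeSubfield.

(* Main.v *)
Require Import Defs.
From HB Require Import structures.
From mathcomp Require Import all_boot all_order all_algebra all_field ring.

(** Self-orthogonality of the code generated by [G] is the equation
    [G *m G^T = 0] between the rows of [G].  The hypotheses on the design say
    that the Gram matrix of the incidence matrix is [(a - d) I + d J], with
    [J] the all-one matrix ([incidence_gram]).  A block [s I] adjoined to [M]
    contributes [s^2 I] to the Gram matrix, and a column of entries [t]
    contributes [t^2 J]; so [s^2 = d - a] and [t^2 = - d] make it vanish, and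
    the four cases of the theorem differ only in which of these two residues
    are zero, in which case the corresponding block is left out.

    When [s != 0], the block [s I] makes the rows independent, which gives the
    dimension.  For [b = v] the code of [[s I, M]] thus has half the dimension
    of the ambient space, hence equals its dual ([self_dual_half]).

    The square roots exist in the larger field, when they are missing in the
    smaller one, because every element of the subfield of order [q] is a
    square in the field of order [q^2]: for odd [q] this is Euler's criterion, as the exponent [(q^2 - 1) / 2] is a
    multiple of [q - 1] ([square_in_quadratic_ext]). *)

Set Implicit Arguments.
Unset Strict Implicit.
Unset Printing Implicit Defensive.

Import GRing.Theory.
Local Open Scope ring_scope.

(** * Square roots in finite fields *)

(** Euler's criterion: under the hypothesis [X^2 - c] divides [X^#|K| - X],
    which is a product of linear factors over [K]. *)
Lemma euler_square (K : finFieldType) (m : nat) (c : K) :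
  #|K| = m.*2.+1 -> c ^+ m = 1 -> exists s : K, s ^+ 2 = c.
Proof.
move=> cardK cm1.
have: ('X^2 - c%:P) %| ('X^#|K| - 'X : {poly K}).
  have -> : 'X^#|K| - 'X = 'X * (('X^2) ^+ m - c%:P ^+ m) :> {poly K}.
    by rewrite -polyC_exp cm1 -exprM mul2n cardK exprS mulrBr mulr1.
  by rewrite subrXX dvdp_mull ?dvdp_mulr.
rewrite finField_genPoly => /dvdp_prod_XsubC[msk].
case: (mask msk _) => [|x xs] eqX2.
  have := eqp_size eqX2.
  by rewrite big_nil size_polyC oner_eq0 size_XnsubC.
exists x; apply/eqP; rewrite -subr_eq0.
have : root ('X^2 - c%:P) x.
  by rewrite (eqp_root eqX2) big_cons rootM root_XsubC eqxx.
by rewrite rootE !hornerE.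
Qed.

(** The hypothesis [c ^+ q = c] singles out the elements of the subfield of
    order [q].  For even [q], halving the exponent gives a root directly. *)
Lemma square_in_quadratic_ext (K : finFieldType) (q : nat) (c : K) :
  #|K| = (q ^ 2)%N -> c ^+ q = c -> exists s : K, s ^+ 2 = c.
Proof.
move=> cardK cq; have [-> | c0] := eqVneq c 0; first by exists 0; rewrite expr0n.
have [odd_q | even_q] := boolP (odd q); last first.
  exists (c ^+ q./2); rewrite -exprM -[RHS]cq; congr (_ ^+ _).
  by rewrite muln2 even_halfK.
have q_def : q = q./2.*2.+1 by rewrite -[LHS]odd_double_half odd_q.
have cq1 : c ^+ q./2.*2 = 1.
  by apply: (mulfI c0); rewrite -exprS -q_def mulr1.
(* (q^2 - 1) / 2 = (q - 1) * ((q + 1) / 2) *)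
apply: (@euler_square _ (q./2.*2 * q./2.+1)); last by rewrite exprM cq1 expr1n.
rewrite cardK; move: (q./2) q_def => h ->.
by rewrite -!muln2; ring.
Qed.

Section PrimeResidues.

Variables (p : nat) (F : finFieldType).
Hypothesis pcharF : p \in [pchar F].

Let p_prime : prime p := pcharf_prime pcharF.

Lemma of_Fp_nat n : of_Fp F (n%:R : 'F_p) = n%:R.
Proof.
rewrite /of_Fp val_Fp_nat // [in RHS](divn_eq n p) natrD natrM.
by rewrite (pcharf0 pcharF) mulr0 add0r.
Qed.

Lemma of_FpD : {morph @of_Fp p F : x y / x + y}.
Proof. by move=> x y; rewrite -[x]natr_Zp -[y]natr_Zp -natrD !of_Fp_nat natrD. Qed.

Lemma of_Fp0 : of_Fp F (0 : 'F_p) = 0. Proof. exact: (of_Fp_nat 0). Qed.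

Lemma of_FpN : {morph @of_Fp p F : x / - x}.
Proof. by move=> x; apply/eqP; rewrite -addr_eq0 -of_FpD addNr of_Fp0. Qed.

Lemma of_Fp_eq0 (c : 'F_p) : (of_Fp F c == 0) = (c == 0).
Proof.
by rewrite /of_Fp -(dvdn_pcharf pcharF) (dvdn_pcharf (pchar_Fp p_prime)) natr_Zp.
Qed.

Lemma is_sqrt_neq0 (c : 'F_p) (s : F) : is_sqrt c s -> c != 0 -> s != 0.
Proof.
by move=> sE; apply: contra_neq => s0; apply/eqP; rewrite -of_Fp_eq0 -sE s0 expr0n.
Qed.

Lemma of_Fp_expX (l : nat) (c : 'F_p) : of_Fp F c ^+ (p ^ l) = of_Fp F c.
Proof.
elim: l => [|l IH]; first by rewrite expn0 expr1.
by rewrite expnSr exprM IH -(pFrobenius_autE pcharF) pFrobenius_aut_nat.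
Qed.

Lemma is_sqrt_quadratic_ext l (c : 'F_p) :
  #|F| = ((p ^ l) ^ 2)%N -> exists s : F, is_sqrt c s.
Proof. by move=> cardF; apply: square_in_quadratic_ext cardF (of_Fp_expX l c). Qed.

End PrimeResidues.

Lemma sqrt_fieldP p l (Fq Fq2 : finFieldType) (cs : seq 'F_p) :
    prime p -> #|Fq| = (p ^ l)%N -> #|Fq2| = ((p ^ l) ^ 2)%N ->
  let F := sqrt_field Fq Fq2 cs in
  p \in [pchar F] /\ forall c, c \in cs -> exists s : F, is_sqrt c s.
Proof.
move=> p_prime cardFq cardFq2; rewrite /sqrt_field.
case: ifP => [/allP sq | _].
  split; first exact: card_finPcharP cardFq p_prime.
  by move=> c /sq/existsP[s /eqP]; exists s.
have pcharFq2 : p \in [pchar Fq2].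
  by apply: (@card_finPcharP _ _ (l * 2)) p_prime; rewrite cardFq2 expnM.
by split=> // c _; apply: is_sqrt_quadratic_ext cardFq2.
Qed.

(** * Codes and their generator matrices *)

Section GeneratedCodes.

Variables (F : finFieldType) (m n : nat).
Implicit Types (G : 'M[F]_(m, n)) (x y : 'rV[F]_n).

Lemma gen_code_tuple G : gen_code G = <<[tuple row i G | i < m]>>%VS.
Proof. by []. Qed.

Lemma mem_gen_code G x : (x \in gen_code G) = (x <= G)%MS.
Proof.
rewrite gen_code_tuple; apply/idP/idP => [/coord_span-> | /submxP[u ->]].
  apply: summx_sub => i _.
  by rewrite -tnth_nth tnth_mktuple scalemx_sub ?row_sub.
rewrite mulmx_sum_row memv_suml // => i _; apply/memvZ/memv_span.
by rewrite -(tnth_mktuple (fun j => row j G) i) mem_tnth.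
Qed.

Lemma dim_gen_code G : row_free G -> \dim (gen_code G) = m.
Proof.
move=> freeG; rewrite gen_code_tuple -[RHS](size_tuple [tuple row i G | i < m]).
apply/eqP; change (free [tuple row i G | i < m]); apply/freeP => u u0 i.
have: \row_j u j *m G = 0 *m G.
  rewrite mul0mx mulmx_sum_row -[RHS]u0; apply: eq_bigr => j _.
  by rewrite mxE -tnth_nth tnth_mktuple.
by move/(row_free_inj freeG)/rowP/(_ i); rewrite !mxE.
Qed.

Lemma innerE x y : inner x y = (x *m y^T) 0 0.
Proof. by rewrite mxE; apply: eq_bigr => i _; rewrite mxE. Qed.

Lemma mem_dual_gen_code G x :
  (x \in dual_code (gen_code G)) = (x <= kermx G^T)%MS.
Proof.
rewrite inE; apply/forall_inP/sub_kermxP => [orth | xG y].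
  apply/rowP => i; have := orth (row i G).
  rewrite mem_gen_code row_sub innerE tr_row => /(_ isT)/eqP.
  by rewrite colE mulmxA -colE mxE => ->; rewrite mxE.
by rewrite mem_gen_code innerE => /submxP[u ->]; rewrite trmx_mul mulmxA xG mul0mx mxE.
Qed.

Lemma self_orthogonal_gram G : G *m G^T = 0 -> self_orthogonal (gen_code G).
Proof.
move=> GG x; rewrite mem_gen_code mem_dual_gen_code => /submx_trans; apply.
exact/sub_kermxP.
Qed.

(** The dual has dimension [n - m = m], so the inclusion is an equality. *)
Lemma self_dual_half G :
  row_free G -> n = (m + m)%N -> G *m G^T = 0 -> self_dual (gen_code G).
Proof.
move=> freeG n_def GG x; rewrite mem_gen_code mem_dual_gen_code.
have GK : (G <= kermx G^T)%MS by apply/sub_kermxP.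
suff eqGK : (G == kermx G^T)%MS by rewrite (eqmxP eqGK).
rewrite -(mxrank_leqif_eq GK) mxrank_ker mxrank_tr (eqP freeG).
by rewrite n_def addnK.
Qed.

End GeneratedCodes.

Lemma row_free_scalar_block (F : fieldType) b n (s : F) (A : 'M[F]_(b, n)) :
  s != 0 -> row_free (row_mx (s *: 1%:M) A).
Proof.
move=> s0; apply/row_freeP; exists (col_mx (s^-1 *: 1%:M) 0).
by rewrite mul_row_col mulmx0 addr0 -scalemxAl mul1mx scalerA mulfV // scale1r.
Qed.

Lemma row_free_row_mx (F : fieldType) b n1 n2
    (A : 'M[F]_(b, n1)) (B : 'M[F]_(b, n2)) :
  row_free A -> row_free (row_mx A B).
Proof.
move=> /row_freeP[A' AA']; apply/row_freeP; exists (col_mx A' 0).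
by rewrite mul_row_col mulmx0 addr0.
Qed.

(** * Gram matrices *)

Lemma gram_row_mx (F : fieldType) b n1 n2 (A : 'M[F]_(b, n1)) (B : 'M_(b, n2)) :
  row_mx A B *m (row_mx A B)^T = A *m A^T + B *m B^T.
Proof. by rewrite tr_row_mx mul_row_col. Qed.

Lemma gram_scalar (F : fieldType) b (s : F) :
  (s *: 1%:M) *m (s *: 1%:M)^T = s ^+ 2 *: 1%:M :> 'M[F]_b.
Proof. by rewrite linearZ /= trmx1 -scalemxAl mul1mx scalerA. Qed.

Lemma gram_ones (F : fieldType) b (t : F) :
  (t *: (const_mx 1 : 'cV[F]_b)) *m (t *: const_mx 1)^T =
  t ^+ 2 *: const_mx 1 :> 'M[F]_b.
Proof. by apply/matrixP => i j; rewrite !mxE big_ord1 !mxE !mulr1. Qed.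

Section Design.

Variables (p v b k r : nat) (inc : 'I_v -> 'I_b -> bool) (a d : 'F_p).
Hypothesis design : is_1design inc k r.
Hypothesis k_mod : k%:R = a.
Hypothesis d_mod : forall i j : 'I_b, i != j ->
  #|block_pts inc i :&: block_pts inc j|%:R = d.

(** The [(i, j)] entry counts the points common to two blocks: this is [d] off
    the diagonal and [k = (a - d) + d] on it. *)
Lemma incidence_gram (F : finFieldType) : p \in [pchar F] ->
  incidence_mx inc F *m (incidence_mx inc F)^T =
  of_Fp F (a - d) *: 1%:M + of_Fp F d *: const_mx 1.
Proof.
move=> pcharF; apply/matrixP => i j.
have -> : (incidence_mx inc F *m (incidence_mx inc F)^T) i j =
          #|block_pts inc i :&: block_pts inc j|%:R.
  rewrite mxE -sum1_card natr_sum [RHS]big_mkcond /=; apply: eq_bigr => P _.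
  by rewrite !mxE !inE -natrM mulnb; case: (_ && _).
rewrite !mxE mulr1; have [<- | neq_ij] := eqVneq i j.
  by rewrite setIid design.1 mulr1 -of_FpD // subrK -k_mod of_Fp_nat.
by rewrite mulr0 add0r -(d_mod neq_ij) of_Fp_nat.
Qed.

Section Extensions.

Variables (F : finFieldType) (pcharF : p \in [pchar F]).
Local Notation M := (incidence_mx inc F).
Local Notation one := (const_mx 1 : 'cV[F]_b).

Lemma gram_scalar_incidence_ones (s t : F) :
    is_sqrt (d - a) s -> is_sqrt (- d) t ->
  let G := row_mx (row_mx (s *: 1%:M) M) (t *: one) in G *m G^T = 0.
Proof.
move=> sE tE G; rewrite !gram_row_mx gram_scalar gram_ones incidence_gram //.
by rewrite sE tE addrA -scalerDl -of_FpD // addrA subrK subrr of_Fp0 // scale0r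
  add0r -scalerDl -of_FpD // subrr of_Fp0 // scale0r.
Qed.

Lemma gram_scalar_incidence (s : F) : d = 0 -> is_sqrt (- a) s ->
  let G := row_mx (s *: 1%:M) M in G *m G^T = 0.
Proof.
move=> d0 sE G; rewrite gram_row_mx gram_scalar incidence_gram // sE d0.
by rewrite of_Fp0 // scale0r addr0 subr0 -scalerDl -of_FpD // addNr of_Fp0 //
  scale0r.
Qed.

Lemma gram_incidence_ones (t : F) : a = d -> is_sqrt (- d) t ->
  let G := row_mx M (t *: one) in G *m G^T = 0.
Proof.
move=> ad tE G; rewrite gram_row_mx gram_ones incidence_gram // tE ad.
by rewrite subrr of_Fp0 // scale0r add0r -scalerDl -of_FpD // subrr of_Fp0 //
  scale0r.
Qed.

Lemma code_scalar_incidence_ones (s t : F) :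
    a != d -> is_sqrt (d - a) s -> is_sqrt (- d) t ->
  let C := gen_code (row_mx (row_mx (s *: 1%:M) M) (t *: one)) in
  \dim C = b /\ self_orthogonal C.
Proof.
move=> ad sE tE C; split; last exact/self_orthogonal_gram/gram_scalar_incidence_ones.
apply/dim_gen_code/row_free_row_mx/row_free_scalar_block.
by apply: is_sqrt_neq0 sE _; rewrite // subr_eq0 eq_sym.
Qed.

End Extensions.

End Design.

Theorem theorem2 (p l : nat) (Fq Fq2 : finFieldType)
    (p_prime : prime p) (l_gt0 : (0 < l)%N)
    (card_Fq : #|Fq| = (p ^ l)%N) (card_Fq2 : #|Fq2| = ((p ^ l) ^ 2)%N)
    (v b k r : nat) (inc : 'I_v -> 'I_b -> bool)
    (design : is_1design inc k r)
    (a d : 'F_p)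
    (k_mod : k%:R = a)
    (d_mod : forall i j : 'I_b, i != j ->
       #|block_pts inc i :&: block_pts inc j|%:R = d) :
  [/\ (* 1 *)
      a = 0 -> d = 0 -> self_orthogonal (gen_code (incidence_mx inc Fq)),
      (* 2 *)
      a = 0 -> d != 0 ->
      let F := sqrt_field Fq Fq2 [:: d; - d] in
      (exists s t : F, is_sqrt d s /\ is_sqrt (- d) t) /\
      (forall s t : F, is_sqrt d s -> is_sqrt (- d) t ->
         let C := gen_code
           (row_mx (row_mx (s *: 1%:M) (incidence_mx inc F))
                   (t *: (const_mx 1 : 'cV[F]_b))) in
         \dim C = b /\ self_orthogonal C),
      (* 3 *)
      a != 0 -> d = 0 ->
      let F := sqrt_field Fq Fq2 [:: - a] in
      (exists s : F, is_sqrt (- a) s) /\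
      (forall s : F, is_sqrt (- a) s ->
         let C := gen_code (row_mx (s *: 1%:M) (incidence_mx inc F)) in
         [/\ \dim C = b, self_orthogonal C & b = v -> self_dual C])
    & (* 4 *)
      a != 0 -> d != 0 ->
      (* (a) *)
      (a = d ->
       let F := sqrt_field Fq Fq2 [:: - a] in
       (exists t : F, is_sqrt (- a) t) /\
       (forall t : F, is_sqrt (- a) t ->
          self_orthogonal
            (gen_code (row_mx (incidence_mx inc F)
                              (t *: (const_mx 1 : 'cV[F]_b)))))) /\
      (* (b) *)
      (a != d ->
       let F := sqrt_field Fq Fq2 [:: d - a; - d] in
       (exists s t : F, is_sqrt (d - a) s /\ is_sqrt (- d) t) /\
       (forall s t : F, is_sqrt (d - a) s -> is_sqrt (- d) t ->
          let C := gen_code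
            (row_mx (row_mx (s *: 1%:M) (incidence_mx inc F))
                    (t *: (const_mx 1 : 'cV[F]_b))) in
          \dim C = b /\ self_orthogonal C))].
Proof.
have sqrtP cs := sqrt_fieldP cs p_prime card_Fq card_Fq2.
have codeP := code_scalar_incidence_ones design k_mod d_mod.
split.
- move=> a0 d0; apply: self_orthogonal_gram.
  rewrite (incidence_gram design k_mod d_mod (card_finPcharP card_Fq p_prime)).
  by rewrite a0 d0 subr0 /of_Fp !scale0r addr0.
- move=> a0 d0 F; have [pcharF sq] := sqrtP [:: d; - d].
  split.
    have [|s sE] := sq d; first by rewrite inE eqxx.
    have [|t tE] := sq (- d); first by rewrite !inE eqxx orbT.
    by exists s, t.
  by move=> s t sE tE; apply: codeP => //; rewrite a0 ?subr0 // eq_sym.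
- move=> a0 d0 F; have [pcharF sq] := sqrtP [:: - a].
  split=> [|s sE C]; first by apply: sq; rewrite inE eqxx.
  have freeG : row_free (row_mx (s *: 1%:M) (incidence_mx inc F)).
    apply: row_free_scalar_block; apply: is_sqrt_neq0 sE _ => //.
    by rewrite oppr_eq0.
  have gramG := gram_scalar_incidence design k_mod d_mod pcharF d0 sE.
  split=> [||bv]; first exact: dim_gen_code.
    exact: self_orthogonal_gram.
  by apply: self_dual_half; rewrite // bv.
move=> a0 d0; split=> [ad | ad] F.
  have [pcharF sq] := sqrtP [:: - a].
  split=> [|t tE]; first by apply: sq; rewrite inE eqxx.
  apply/self_orthogonal_gram/(gram_incidence_ones design k_mod d_mod) => //.
  by rewrite -ad.
have [pcharF sq] := sqrtP [:: d - a; - d].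
split; last by move=> s t; apply: codeP.
have [|s sE] := sq (d - a); first by rewrite inE eqxx.
have [|t tE] := sq (- d); first by rewrite !inE eqxx orbT.
by exists s, t.
Qed.
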